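(* Let $\Sigma$ be an alphabet of size $m\ge 3$ and let $n\ge 1$. If $L$ is a regular language over $\Sigma$ with $\mathrm{sc}(L)\le n$, then $\mathrm{sc}(\mathrm{root}(L))\le n^n-\binom n2$. Furthermore, this bound is tight: for every such $\Sigma$ and $n$ there exists a regular language $L$ over $\Sigma$ with $\mathrm{sc}(L)\le n$ and $\mathrm{sc}(\mathrm{root}(L))=n^n-\binom n2$.
   Context: For a language $L\subseteq\Sigma^*$ over a finite alphabet $\Sigma$, $\mathrm{root}(L)=\{w\in\Sigma^* : \exists n\ge 1 \text{ such that } w^n\in L\}$. The state complexity $\mathrm{sc}(L)$ of a regular language $L\subseteq\Sigma^*$ is the number of states of the smallest DFA over $\Sigma$ (with total transition function) recognizing $L$. *)

(* Defs.v *)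
From mathcomp Require Import all_boot.
From Stdlib Require Import Classical.

Set Implicit Arguments.
Unset Strict Implicit.
Unset Printing Implicit Defensive.

Definition language (Sigma : finType) := seq Sigma -> Prop.

(* [dfa_trans] is total, and [dfa_start] forces at least one state. *)
Record dfa (Sigma : finType) := Dfa {
  dfa_state :> finType;
  dfa_start : dfa_state;
  dfa_final : {set dfa_state};
  dfa_trans : dfa_state -> Sigma -> dfa_state
}.

Definition dfa_accepts (Sigma : finType) (A : dfa Sigma) (w : seq Sigma) : bool :=
  foldl (@dfa_trans Sigma A) (dfa_start A) w \in dfa_final A.

Definition recognizes (Sigma : finType) (A : dfa Sigma) (L : language Sigma) : Prop :=
  forall w, dfa_accepts A w <-> L w.

Definition regular (Sigma : finType) (L : language Sigma) : Prop :=
  exists A : dfa Sigma, recognizes A L.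

(* [has_sc L k] is sc(L) = k. It is a relation because sc is only defined on
   regular languages; [regularP] and [has_sc_inj] show that it is the graph of
   a function with exactly that domain. *)
Definition has_sc (Sigma : finType) (L : language Sigma) (k : nat) : Prop :=
  (exists2 A : dfa Sigma, recognizes A L & #|A| = k) /\
  (forall A : dfa Sigma, recognizes A L -> k <= #|A|).

Definition word_pow (Sigma : finType) (w : seq Sigma) (k : nat) : seq Sigma :=
  flatten (nseq k w).

Definition lang_root (Sigma : finType) (L : language Sigma) : language Sigma :=
  fun w => exists2 k : nat, 1 <= k & L (word_pow w k).

Lemma has_sc_inj (Sigma : finType) (L : language Sigma) (j k : nat) :
  has_sc L j -> has_sc L k -> j = k.
Proof.
move=> [[A AL <-] minA] [[B BL <-] minB].
by apply/eqP; rewrite eqn_leq minA // minB.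
Qed.

Lemma regularP (Sigma : finType) (L : language Sigma) :
  regular L <-> exists k, has_sc L k.
Proof.
split=> [[A AL] | [k [[A AL _] _]]]; last by exists A.
have [s] := ubnP #|A|; elim: s A AL => // s IHs A AL ltAs.
have [[B [BL ltBA]] | minA] :=
  classic (exists B : dfa Sigma, recognizes B L /\ #|B| < #|A|).
  by apply: (IHs B BL); apply: leq_trans ltBA _.
exists #|A|; split; first by exists A.
by move=> B BL; rewrite leqNgt; apply/negP=> ltBA; apply: minA; exists B.
Qed.

(* Main.v *)
Require Import Defs.
From mathcomp Require Import all_boot all_fingroup all_algebra.

(* If A has states Q, start q0 and final set F, then root(L(A)) is recognized by
   an automaton with states Q^Q, the transformation f being final when the
   forward orbit of f(q0) under f meets F.  Write [spike i j] for the map sending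
   q0 to i and everything else to j.  If F is contained in {q0}, then
   [spike i j] and [spike j i] are equivalent states, which saves one state per
   unordered pair {i, j}.  If F contains some z <> q0, then the value of f at z is
   irrelevant and may be reset to f(q0), which no [spike i j] with i <> j
   survives.  In both cases the spikes with i > j can be removed.

   Conversely, let F = {q0}.  Any two other transformations f <> g are separated
   by composing with a map taking only two values, q0 (at a single point) and a
   trapping state x.  Three letters generate all transformations of Q: an n-cycle,
   a transposition, and a map of rank n - 1. *)

Set Implicit Arguments.
Unset Strict Implicit.
Unset Printing Implicit Defensive.

(** * Acceptance in terms of orbits, and the number of spikes *)

Section Hits.
Variables (Q : finType) (F : {set Q}) (q0 : Q).

(** The orbit starts at [f q0] because the exponent in a root is at least 1. *)
Definition hits (f : Q -> Q) : bool := [exists y in F, fconnect f (f q0) y].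

Lemma hitsP (f : Q -> Q) :
  reflect (exists2 k, 1 <= k & iter k f q0 \in F) (hits f).
Proof.
apply: (iffP exists_inP) => [[y Fy /iter_findex fy] | [[//|k] _ Fk]].
  by exists (findex f (f q0) y).+1; rewrite // iterSr fy.
by exists (iter k.+1 f q0) => //; rewrite iterSr fconnect_iter.
Qed.

Lemma eq_hits (f g : Q -> Q) : f =1 g -> hits f = hits g.
Proof.
by move=> fg; apply/hitsP/hitsP => -[k k_gt0 Fk]; exists k => //;
   move: Fk; rewrite (eq_iter fg).
Qed.

(* Reaching [z] already means acceptance, so what happens after [z] is
   irrelevant; [z != q0] ensures that [z] is reached after at least one step. *)
Lemma hits_agree_off (z : Q) (f g : Q -> Q) :
  z \in F -> z != q0 -> (forall x, x != z -> f x = g x) -> hits f = hits g.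
Proof.
move=> Fz zq0; wlog suff imp: f g /
    (forall x, x != z -> f x = g x) -> hits f -> hits g.
  by move=> fg; apply/idP/idP; apply: imp => // x /fg.
move=> fg /hitsP[k k_gt0 Fk]; apply/hitsP.
(* Invariant: the iterates still agree, or that of [g] has already met [F]. *)
have [e | //] : iter k f q0 = iter k g q0 \/ exists2 j, 1 <= j & iter j g q0 \in F.
  elim: k {k_gt0 Fk} => [|k [e|]]; [by left | | by right].
  have [ez | nez] := eqVneq (iter k g q0) z; last by left; rewrite /= e fg.
  right; exists k; last by rewrite ez.
  by case: k ez {e} => // /eqP; rewrite eq_sym (negPf zq0).
by exists k; rewrite -?e.
Qed.

Definition spike (i j : Q) : {ffun Q -> Q} := [ffun x => if x == q0 then i else j].

(** The orbit of [q0] goes to [h i] and, unless that is [q0] again, on to [h j]. The symmetry in [i]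
    and [j] is what makes opposite spikes equivalent. *)
Lemma hits_spike (h : Q -> Q) i j : F \subset [set q0] ->
  hits (h \o spike i j) = (h i \in F) || (h j \in F).
Proof.
move=> /subsetP sF; have Fq0 x : x \in F -> x = q0 by move/sF; rewrite inE => /eqP.
apply/hitsP/orP => [[[//|k] _] | [Fi | Fj]].
- by rewrite /= ffunE; case: ifP; [left | right].
- by exists 1; rewrite //= ffunE eqxx.
have [hi | nhi] := eqVneq (h i) q0.
  by exists 1; rewrite //= ffunE eqxx hi -(Fq0 _ Fj).
by exists 2; rewrite //= !ffunE eqxx (negPf nhi).
Qed.

(** The enumeration is an arbitrary total order; it selects one orientation of each unordered
    pair. *)
Definition descents : {set Q * Q} :=
  [set p | enum_rank p.2 < enum_rank p.1].

Lemma card_descents : #|descents| = 'C(#|Q|, 2).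
Proof.
rewrite -bin2_sum big_mkord -sum1_card.
rewrite (eq_bigl (fun p : Q * Q => enum_rank p.2 < enum_rank p.1)); last first.
  by move=> p; rewrite inE.
rewrite -(pair_big_dep xpredT (fun i j => enum_rank j < enum_rank i)
           (fun _ _ => 1)) /=.
rewrite (reindex (@enum_val Q Q)) /=; last first.
  by exists enum_rank => x _; [exact: enum_valK | exact: enum_rankK].
apply: eq_bigr => i _; rewrite (reindex (@enum_val Q Q)) /=; last first.
  by exists enum_rank => x _; [exact: enum_valK | exact: enum_rankK].
transitivity (\sum_(j < i) 1); last by rewrite sum1_card card_ord.
rewrite (eq_bigl (fun j : 'I_#|Q| => j < i)); last by move=> j; rewrite !enum_valK.
by rewrite (big_ord_narrow (F := fun=> 1) (ltnW (ltn_ord i))).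
Qed.

Lemma spike_inj i j i' j' : i != j -> spike i j = spike i' j' -> i = i' /\ j = j'.
Proof.
move=> ij /ffunP e.
have [x xq0] : exists x, x != q0.
  have [iq0 | ] := eqVneq i q0; last by exists i.
  by exists j; rewrite eq_sym -iq0.
by split; [have := e q0 | have := e x]; rewrite !ffunE ?eqxx ?(negPf xq0).
Qed.

Definition spikes : {set {ffun Q -> Q}} := [set spike p.1 p.2 | p in descents].

Lemma descent_neq p : p \in descents -> p.1 != p.2.
Proof. by rewrite inE; apply: contraTneq => ->; rewrite ltnn. Qed.

Lemma card_not_spikes : #|~: spikes| = #|Q| ^ #|Q| - 'C(#|Q|, 2).
Proof.
rewrite cardsCs setCK card_ffun card_in_imset ?card_descents //.
move=> [i j] [i' j'] /descent_neq ij _ /(spike_inj ij) /= [-> ->] //.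
Qed.

End Hits.

(** * Separation of the remaining transformations *)

Lemma not_spikes_separated (Q : finType) (q0 : Q) (f g : {ffun Q -> Q}) :
    f \in ~: spikes q0 -> g \in ~: spikes q0 ->
    (forall h : {ffun Q -> Q},
       hits [set q0] q0 (h \o f) = hits [set q0] q0 (h \o g)) ->
  f = g.
Proof.
pose peak (a x : Q) : {ffun Q -> Q} := [ffun y => if y == a then q0 else x].
(* Under [peak a x \o u], the orbit of [q0] is trapped at the fixed point [x]. *)
have trap (u : {ffun Q -> Q}) a x : u q0 != a -> u x != a -> x != q0 ->
    ~~ hits [set q0] q0 (peak a x \o u).
  move=> ua uxa xq0; apply/hitsP => -[[//|k] _].
  suff ->: iter k.+1 (peak a x \o u) q0 = x by rewrite inE (negPf xq0).
  elim: k => [|k IH]; first by rewrite /= ffunE (negPf ua).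
  by rewrite iterS IH /= ffunE (negPf uxa).
move=> fS gS sep; apply/ffunP.
have [e0 x | ne0] := eqVneq (f q0) (g q0).
  have [-> // | xq0] := eqVneq x q0; apply/eqP/negPn/negP => nfg.
  wlog nfx: f g fS gS sep e0 nfg / f x != f q0.
    move=> W; have [fx|] := eqVneq (f x) (f q0); last exact: W nfg.
    apply: (W g f) => //; first by rewrite eq_sym.
    by rewrite -e0 -fx eq_sym.
  (* With [f] the orbit runs from [q0] to [x] and back to [q0]; with [g] it is trapped at [x]. *)
  have /negP[] : ~~ hits [set q0] q0 (peak (f x) x \o g).
    by apply: trap; rewrite // -?e0 eq_sym.
  rewrite -sep; apply/hitsP; exists 2; rewrite //= !ffunE.
  by rewrite [f q0 == _]eq_sym (negPf nfx) eqxx inE.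
(* If [v x != u q0] for some [x != q0], then [peak (u q0) x] returns to [q0] in one step after [u]
   but is trapped after [v]. *)
have const (u v : {ffun Q -> Q}) : u q0 != v q0 ->
    (forall h : {ffun Q -> Q},
       hits [set q0] q0 (h \o u) = hits [set q0] q0 (h \o v)) ->
    v = spike q0 (v q0) (u q0).
  move=> ne s; apply/ffunP => x; rewrite ffunE.
  have [-> // | xq0] := eqVneq; apply/eqP/negPn/negP => nvx.
  have /negP[] : ~~ hits [set q0] q0 (peak (u q0) x \o v).
    by apply: trap; rewrite // eq_sym.
  by rewrite -s; apply/hitsP; exists 1; rewrite //= ffunE eqxx inE.
have eg := const f g ne0 sep.
have ef : f = spike q0 (f q0) (g q0).
  by apply: const => [|h]; [rewrite eq_sym | rewrite sep].
(* Now [f] and [g] are opposite spikes, so one of them comes from a descent. *)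
have := ne0; rewrite -(inj_eq enum_rank_inj) -val_eqE neq_ltn.
case/orP => lt_fg.
  move: gS; rewrite inE => /negP[]; rewrite {1}eg; apply/imsetP.
  by exists (g q0, f q0); rewrite ?inE.
move: fS; rewrite inE => /negP[]; rewrite {1}ef; apply/imsetP.
by exists (f q0, g q0); rewrite ?inE.
Qed.

(** * The automaton of transformations and the upper bound *)

Section RootDfa.
Variables (Sigma : finType) (A : dfa Sigma).

Definition word_fun (w : seq Sigma) : {ffun A -> A} :=
  [ffun q => foldl (@dfa_trans Sigma A) q w].

Lemma foldl_word_pow w k q :
  foldl (@dfa_trans Sigma A) q (word_pow w k) = iter k (word_fun w) q.
Proof.
elim: k q => // k IH q.
by rewrite -[word_pow w k.+1]/(w ++ word_pow w k) foldl_cat IH iterSr ffunE.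
Qed.

Lemma lang_rootE L w : recognizes A L ->
  lang_root L w <-> hits (dfa_final A) (dfa_start A) (word_fun w).
Proof.
move=> AL; split=> [[k k_gt0 /AL] | /hitsP[k k_gt0 Fk]].
  by rewrite /dfa_accepts foldl_word_pow => Fk; apply/hitsP; exists k.
by exists k => //; apply/AL; rewrite /dfa_accepts foldl_word_pow.
Qed.

Definition root_dfa : dfa Sigma :=
  @Dfa Sigma {ffun A -> A} [ffun q => q]
    [set f : {ffun A -> A} | hits (dfa_final A) (dfa_start A) f]
    (fun f a => [ffun q => dfa_trans (f q) a]).

Lemma foldl_root_dfa (f : {ffun A -> A}) w :
  foldl (@dfa_trans Sigma root_dfa) f w = [ffun q => word_fun w (f q)].
Proof.
elim: w f => [|a w IH] f /=; first by apply/ffunP => q; rewrite !ffunE.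
by rewrite IH; apply/ffunP => q; rewrite !ffunE.
Qed.

Lemma root_dfa_recognizes L : recognizes A L -> recognizes root_dfa (lang_root L).
Proof.
move=> AL w; rewrite /dfa_accepts foldl_root_dfa inE (lang_rootE w AL).
by rewrite (@eq_hits _ _ _ _ (word_fun w)) // => q; rewrite !ffunE.
Qed.

End RootDfa.

(** Replacing the current state by its representative after every letter keeps the run inside [R]
    and does not change which continuations are accepted. *)
Lemma dfa_retract (Sigma : finType) (A : dfa Sigma) (L : language Sigma)
    (R : {set A}) (c : A -> A) :
    recognizes A L -> (forall s, c s \in R) ->
    (forall s w, (foldl (@dfa_trans Sigma A) (c s) w \in dfa_final A) =
                 (foldl (@dfa_trans Sigma A) s w \in dfa_final A)) ->
  exists2 B : dfa Sigma, recognizes B L & #|B| = #|R|.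
Proof.
move=> AL cR ceq; pose T := {s : A | s \in R}.
pose mk s : T := exist _ (c s) (cR s).
exists (@Dfa Sigma T (mk (dfa_start A)) [set s : T | val s \in dfa_final A]
          (fun s a => mk (dfa_trans (val s) a))); last by rewrite card_sig.
move=> w; rewrite -AL /dfa_accepts -ceq /=.
rewrite -[c (dfa_start A)]/(val (mk (dfa_start A))).
elim: w (mk _) => [|a w IH] s /=; first by rewrite inE.
by rewrite IH /= ceq.
Qed.

Lemma root_sc_le (Sigma : finType) (A : dfa Sigma) (L : language Sigma) :
    recognizes A L ->
  exists2 B : dfa Sigma, recognizes B (lang_root L)
    & #|B| = #|A| ^ #|A| - 'C(#|A|, 2).
Proof.
move=> AL; set q0 := dfa_start A; set F := dfa_final A.
(* Here [h] stands for the action of the remaining input. *)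
suff [c cR ceq] : exists2 c : {ffun A -> A} -> {ffun A -> A},
    forall f, c f \in ~: spikes q0
    & forall f (h : A -> A), hits F q0 (h \o c f) = hits F q0 (h \o f).
  rewrite -(card_not_spikes q0).
  apply: (@dfa_retract _ (root_dfa A) _ _ c (root_dfa_recognizes AL) cR) => f w.
  rewrite !foldl_root_dfa !inE -/q0 -/F.
  rewrite -[RHS](_ : hits F q0 (word_fun A w \o f) = _); last first.
    by apply: eq_hits => q; rewrite ffunE.
  by rewrite -ceq; apply: eq_hits => q; rewrite ffunE.
have [[z Fz zq0] | noz] := altP (@exists_inP _ (mem F) (fun z => z != q0)).
  exists (fun f => [ffun x => if x == z then f q0 else f x]) => [f | f h].
    rewrite inE; apply/imsetP => -[p /descent_neq/eqP pD /ffunP e]; apply: pD.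
    have := e q0; have := e z; rewrite !ffunE !eqxx (negPf zq0).
    by rewrite eq_sym (negPf zq0) => -> ->.
  by apply: (hits_agree_off Fz zq0) => x xz; rewrite /= ffunE (negPf xz).
have sF : F \subset [set q0].
  apply/subsetP => z Fz; rewrite inE; apply: contraR noz => zq0.
  by apply/exists_inP; exists z.
(* Reversing a descent gives an ascent, whose spike is kept. *)
pose flip (f : {ffun A -> A}) :=
  if [pick p in descents A | f == spike q0 p.1 p.2] is Some p
  then spike q0 p.2 p.1 else f.
exists flip => [f | f h]; rewrite /flip;
    case: pickP => [p /andP[pD /eqP ef] | no //].
- rewrite inE; apply/imsetP => -[[i j] ijD /spike_inj].
  rewrite eq_sym (descent_neq pD) => /(_ isT) /= [e1 e2].
  by move: pD ijD; rewrite !inE -e1 -e2 /= => /ltn_trans lt /lt; rewrite ltnn.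
- rewrite inE; apply/imsetP => -[p pD ef].
  by have /andP[] := no p; rewrite pD ef eqxx.
by rewrite ef !(hits_spike h _ _ sF) orbC.
Qed.

(** Needed when sc(L) is below [n]. From [n] to [n.+1] the binomial grows by [n], the power by at
    least [n]. *)
Lemma leq_root_bound k n : 1 <= k -> k <= n ->
  k ^ k - 'C(k, 2) <= n ^ n - 'C(n, 2).
Proof.
move=> k_gt0; elim: n => [|n IH]; first by rewrite leqNgt k_gt0.
rewrite leq_eqVlt => /orP[/eqP -> // | /[!ltnS] kn].
have n_gt0 := leq_trans k_gt0 kn.
apply: leq_trans (IH kn) _; rewrite binS bin1.
have Hn : n ^ n + n <= n.+1 ^ n.+1.
  rewrite expnS mulSn; apply: leq_add; first by rewrite leq_exp2r.
  by rewrite leq_pmulr // expn_gt0.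
by rewrite -(subnDr n) leq_sub2r.
Qed.

(** * Generators of the full transformation monoid *)

(* Restoring one missing value of a non-injective [f] raises its rank, and a
   collapse undoes the change. *)
Lemma transformation_ind (Q : finType) (x0 x1 : Q) (G : {ffun Q -> Q} -> Prop) :
    x0 != x1 -> (forall s : {perm Q}, G [ffun q => s q]) ->
    G [ffun q => if q == x0 then x1 else q] ->
    (forall f g : {ffun Q -> Q}, G f -> G g -> G [ffun q => f (g q)]) ->
  forall f, G f.
Proof.
move=> x01 Gs Gc GM.
have Gcol z u : z != u -> G [ffun q => if q == z then u else q].
  move=> zu; pose s := (tperm x0 z * tperm (tperm x0 z x1) u)%g.
  have s0 : s x0 = z.
    rewrite permM tpermL tpermD //; last by rewrite eq_sym.
    by rewrite -[X in _ != X](tpermL x0 z) (inj_eq perm_inj) eq_sym.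
  have s1 : s x1 = u by rewrite permM tpermL.
  have := GM _ _ (Gs s) (GM _ _ Gc (Gs s^-1%g)); congr G.
  apply/ffunP => q; rewrite !ffunE -(inj_eq (@perm_inj _ s)) permKV s0.
  by case: ifP => // _; rewrite permKV.
move=> f; have [r] := ubnP #|~: (f @: setT)|; elim: r f => // r IH f ltr.
have [/injectiveP injf | ninjf] := boolP (injectiveb f).
  by have := Gs (perm injf); congr G; apply/ffunP => q; rewrite ffunE permE.
have /injectivePn[x [y xy fxy]] := ninjf.
have [z _ nfz] : exists2 z, z \in [set: Q] & z \notin f @: setT.
  apply/subsetPn; rewrite subTset; apply: contra ninjf => /eqP fT.
  have /imset_injP fI : #|f @: setT| == #|[set: Q]| by rewrite fT.
  by apply/injectiveP => a b; apply: fI; rewrite inE.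
have nf q : f q != z by apply: contraNneq nfz => <-; apply: imset_f; rewrite inE.
pose f' := [ffun q => if q == y then z else f q].
have Gf' : G f'.
  apply: IH; rewrite -ltnS; apply: leq_trans ltr; rewrite ltnS; apply: proper_card.
  rewrite properE !setCS; apply/andP; split; last first.
    apply/subsetPn; exists z => //; apply/imsetP; exists y; first by rewrite inE.
    by rewrite ffunE eqxx.
  apply/subsetP => _ /imsetP[q _ ->]; apply/imsetP.
  have [-> | qy] := eqVneq q y; last by exists q; rewrite ?inE // ffunE (negPf qy).
  by exists x; rewrite ?inE // ffunE (negPf xy).
have := GM _ _ (Gcol z (f x) _) Gf'; rewrite eq_sym nf => /(_ isT); congr G.
apply/ffunP => q; rewrite !ffunE.
by have [-> | qy] := eqVneq q y; rewrite ?eqxx ?(negPf (nf q)).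
Qed.

(** * The extremal automaton and the lower bound *)

Section Extremal.
Import GRing.Theory.
Variables (Sigma : finType) (n : nat).

(** Addition is modulo [n.+2], so the letter of rank 0 acts as a full cycle. All letters of rank at
    least 2 act as the same collapse. *)
Definition extremal_dfa : dfa Sigma :=
  @Dfa Sigma 'I_n.+2 0%R [set 0%R]
    (fun q a => match val (enum_rank a) with
                | 0 => perm (addrI 1%R) q
                | 1 => tperm 0%R 1%R q
                | _ => if q == 0%R then 1%R else q
                end).

Lemma word_fun_extremal (f : {ffun 'I_n.+2 -> 'I_n.+2}) :
  2 < #|Sigma| -> exists w, word_fun extremal_dfa w = f.
Proof.
move=> Sigma_ge3.
have letter i : i < 3 -> exists a : Sigma, val (enum_rank a) = i.
  move=> i3; exists (enum_val (Ordinal (leq_trans i3 Sigma_ge3))).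
  by rewrite enum_valK.
pose G (f : {ffun 'I_n.+2 -> 'I_n.+2}) :=
  exists w, word_fun extremal_dfa w = f.
have GM (u v : {ffun 'I_n.+2 -> 'I_n.+2}) :
    G u -> G v -> G [ffun q => u (v q)].
  move=> [wu <-] [wv <-]; exists (wv ++ wu).
  by apply/ffunP => q; rewrite !ffunE foldl_cat.
apply: (@transformation_ind _ 0%R 1%R G) => // [s|]; last first.
  have [a ra] := letter 2 isT; exists [:: a].
  by apply/ffunP => q; rewrite !ffunE /= ra.
(* The cycle and a transposition of neighbours generate the symmetric group. *)
have : s \in <<[set tperm 0%R 1%R; perm (addrI 1%R)]>>%g.
  by rewrite gen_tpermn_circular_shift ?inE // subr0 coprimen1.
case/gen_prodgP => k [c cP ->].
apply: (big_ind (fun s : {perm _} => G [ffun q => s q])) => [|u v Gu Gv|i _].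
- by exists [::]; apply/ffunP => q; rewrite !ffunE perm1.
- have := GM _ _ Gv Gu; congr G.
  by apply/ffunP => q; rewrite !ffunE permM.
- have /set2P[->|->] := cP i.
    have [a ra] := letter 1 isT; exists [:: a].
    by apply/ffunP => q; rewrite !ffunE /= ra.
  have [a ra] := letter 0 isT; exists [:: a].
  by apply/ffunP => q; rewrite !ffunE /= ra.
Qed.

(** Myhill-Nerode: if words inducing [f] and [g] led [B] to the same state, no suffix, hence no [h],
    would separate [f] from [g]. *)
Lemma root_extremal_sc_ge (B : dfa Sigma) :
    2 < #|Sigma| -> recognizes B (lang_root (dfa_accepts extremal_dfa)) ->
  n.+2 ^ n.+2 - 'C(n.+2, 2) <= #|B|.
Proof.
move=> Sigma_ge3 BL.
have AL : recognizes extremal_dfa (dfa_accepts extremal_dfa) by [].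
have accE w : dfa_accepts B w =
    hits [set 0%R] 0%R (word_fun extremal_dfa w).
  by apply/idP/idP => [/BL/(lang_rootE w AL) | /(lang_rootE w AL)/BL].
have wP (f : {ffun 'I_n.+2 -> 'I_n.+2}) :
    exists w, word_fun extremal_dfa w == f.
  by have [w <-] := word_fun_extremal f Sigma_ge3; exists w.
pose state f := foldl (@dfa_trans Sigma B) (dfa_start B) (xchoose (wP f)).
have := card_not_spikes (0%R : 'I_n.+2); rewrite card_ord => <-.
rewrite -(card_in_imset (f := state)) ?max_card // => f g fR gR efg.
apply: (not_spikes_separated fR gR) => h.
have [v hv] := word_fun_extremal h Sigma_ge3.
have stateE (u : {ffun 'I_n.+2 -> 'I_n.+2}) : hits [set 0%R] 0%R (h \o u) =
    (foldl (@dfa_trans Sigma B) (state u) v \in dfa_final B).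
  rewrite -foldl_cat -[RHS]/(dfa_accepts B _) accE; apply: eq_hits => q.
  rewrite /= -{1}hv -{1}(eqP (xchooseP (wP u))) !ffunE.
  by rewrite foldl_cat.
by rewrite !stateE efg.
Qed.

End Extremal.

Theorem theorem3p27 (m n : nat) (Sigma : finType)
    (hSigma : #|Sigma| = m) (hm : 3 <= m) (hn : 1 <= n) :
  (forall L : language Sigma, regular L ->
     forall k : nat, has_sc L k -> k <= n ->
     exists2 r : nat, has_sc (lang_root L) r & r <= n ^ n - 'C(n, 2)) /\
  (exists L : language Sigma, regular L /\
     exists2 k : nat, has_sc L k /\ k <= n &
     has_sc (lang_root L) (n ^ n - 'C(n, 2))).
Proof.
have dfa_gt0 (A : dfa Sigma) : 0 < #|A|.
  by apply/card_gt0P; exists (dfa_start A).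
have upper (L : language Sigma) (A : dfa Sigma) : recognizes A L -> #|A| <= n ->
    exists2 r : nat, has_sc (lang_root L) r & r <= n ^ n - 'C(n, 2).
  move=> AL An; have [B BL cB] := root_sc_le AL.
  have [r Lr] : exists r, has_sc (lang_root L) r by apply/regularP; exists B.
  exists r => //; apply: leq_trans (Lr.2 B BL) _; rewrite cB.
  exact: leq_root_bound.
split=> [L _ k [[A AL <-] _] | ]; first exact: upper AL.
suff [A An lower] : exists2 A : dfa Sigma, #|A| = n &
    forall B : dfa Sigma, recognizes B (lang_root (dfa_accepts A)) ->
      n ^ n - 'C(n, 2) <= #|B|.
  have AL : recognizes A (dfa_accepts A) by [].
  have rA : regular (dfa_accepts A) by exists A.
  have [k Lk] := (regularP _).1 rA.
  exists (dfa_accepts A); split=> //.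
  exists k; first by split=> //; rewrite -An; apply: Lk.2.
  have [r Lr ler] := upper _ A AL (eq_leq An).
  suff <- : r = n ^ n - 'C(n, 2) by [].
  apply/eqP; rewrite eqn_leq ler; have [[B BL <-] _] := Lr.
  exact: lower.
case: n hn {upper} => [//|[_|n' _]].
  (* For [n = 1] the bound is 1, and every automaton has a state. *)
  by exists (@Dfa Sigma 'I_1 ord0 set0 (fun q _ => q)); rewrite ?card_ord.
exists (@extremal_dfa Sigma n'); first exact: card_ord.
by move=> B; apply: root_extremal_sc_ge; rewrite hSigma.
Qed.
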